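(* Let $G=K\cup_U H$, where $K$ and $H$ are finite graphs with disjoint edge sets which intersect only in the finite vertex set $U=\{u_1,\ldots,u_n\}$. Then there is an isomorphism of $\mathbb Z^3$-graded $\mathbf k$-vector spaces $$\mathcal N_0(G)\cong\bigoplus_{\pi,\sigma\in\Pi(U)}\mathcal N_{U,\pi}(K)\otimes\mathbf k\{\rho(\pi,\sigma),0,0\}\otimes\mathcal N_{U,\sigma}(H).$$
   Context: Graphs are finite and may have loops and multiple edges. $G=K\cup_U H$ means $V(G)=V(K)\cup V(H)$, $V(K)\cap V(H)=U$, and $E(G)=E(K)\sqcup E(H)$. For $S\subseteq E(G)$, $\omega_G(S)$ denotes the number of connected components of the spanning subgraph $(V(G),S)$ (similarly for $K,H$). $\Pi(U)$ is the set of set partitions of $U$, and $|\pi|$ is the number of blocks of $\pi$. For $S\subseteq E(K)$, the boundary partition $\pi_K(S)\in\Pi(U)$ is the partition in which $u_i,u_j$ are in the same block precisely when they are connected in $(V(K),S)$; $\pi_H$ is defined likewise. For $\pi,\sigma\in\Pi(U)$, $\rho(\pi,\sigma)$ is the number of blocks (classes) of the smallest equivalence relation on $U$ containing the equivalence relations represented by both $\pi$ and $\sigma$. Let $\mathbf k$ be a field. For a finite-dimensional $\mathbb Z^3$-graded $\mathbf k$-vector space $M$, the grading shift is $M\{a,b,c\}_{i,j,k}=M_{i-a,j-b,k-c}$; in particular $\mathbf k\{a,b,c\}$ is one-dimensional, concentrated in degree $(a,b,c)$. Tensor products are over $\mathbf k$ with the usual additive grading. Define $$\mathcal N_0(G)=\bigoplus_{S\subseteq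 E(G)}\mathbf k\{\omega_G(S),|S|,|E(G)|-|S|\}$$ and, for $\pi\in\Pi(U)$, $$\mathcal N_{U,\pi}(K)=\bigoplus_{S\subseteq E(K),\ \pi_K(S)=\pi}\mathbf k\{\omega_K(S)-|\pi|,|S|,|E(K)|-|S|\},$$ and likewise $\mathcal N_{U,\sigma}(H)$. *)

(* Defs.v *)
From HB Require Import structures.
From mathcomp Require Import all_boot all_order all_algebra.

Set Implicit Arguments.
Unset Strict Implicit.
Unset Printing Implicit Defensive.

Import GRing.Theory.
Local Open Scope ring_scope.

(* MathComp only provides the vector space structure for constant families. *)

Section DirectProduct.
Variables (k : fieldType) (I : finType) (M : I -> vectType k).

Definition dprodv : Type := {dffun forall i, M i}.
HB.instance Definition _ := Choice.on dprodv.

Implicit Types f g : dprodv.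

Definition dprodv_zero : dprodv := [ffun i : I => 0 : M i].
Definition dprodv_opp f : dprodv := [ffun i : I => - f i : M i].
Definition dprodv_add f g : dprodv := [ffun i : I => f i + g i : M i].
Definition dprodv_scale (a : k) f : dprodv := [ffun i : I => a *: f i : M i].

Fact dprodv_addA : associative dprodv_add.
Proof. by move=> f g h; apply/ffunP => i; rewrite !ffunE addrA. Qed.
Fact dprodv_addC : commutative dprodv_add.
Proof. by move=> f g; apply/ffunP => i; rewrite !ffunE addrC. Qed.
Fact dprodv_add0 : left_id dprodv_zero dprodv_add.
Proof. by move=> f; apply/ffunP => i; rewrite !ffunE add0r. Qed.
Fact dprodv_addN : left_inverse dprodv_zero dprodv_opp dprodv_add.
Proof. by move=> f; apply/ffunP => i; rewrite !ffunE addNr. Qed.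
HB.instance Definition _ := GRing.isZmodule.Build dprodv
  dprodv_addA dprodv_addC dprodv_add0 dprodv_addN.

Fact dprodv_scaleA a b f :
  dprodv_scale a (dprodv_scale b f) = dprodv_scale (a * b) f.
Proof. by apply/ffunP => i; rewrite !ffunE scalerA. Qed.
Fact dprodv_scale1 : left_id 1 dprodv_scale.
Proof. by move=> f; apply/ffunP => i; rewrite !ffunE scale1r. Qed.
Fact dprodv_scaleDr : right_distributive dprodv_scale +%R.
Proof. by move=> a f g; apply/ffunP => i; rewrite !ffunE scalerDr. Qed.
Fact dprodv_scaleDl f :
  {morph dprodv_scale^~ f : a b / a + b >-> a + b}.
Proof. by move=> a b; apply/ffunP => i; rewrite !ffunE scalerDl. Qed.
HB.instance Definition _ := GRing.Zmodule_isLmodule.Build k dprodv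
  dprodv_scaleA dprodv_scale1 dprodv_scaleDr dprodv_scaleDl.

Import VectorInternalTheory.
Fact dprodv_vect_iso :
  Vector.axiom (\sum_(j < #|I|) dim (M (enum_val j)))%N dprodv.
Proof.
pose q j := dim (M (@enum_val I I j)).
pose c j i (e : enum_val j = i) (r : 'rV[k]_(\sum_j q j)) : M i :=
  eq_rect _ (fun i => M i) (@r2v _ (M (enum_val j)) (submxrow r j)) _ e.
exists (fun f : dprodv => \mxrow_j (v2r (f (enum_val j)))).
  move=> a f g; apply/mxrowP => j; rewrite mxrowK.
  have -> : (a *: f + g) (enum_val j) = a *: f (enum_val j) + g (enum_val j).
    by rewrite !ffunE.
  have subD X Y : submxrow (a *: X + Y) j = a *: submxrow X j + submxrow Y j.
    by apply/matrixP => i l; rewrite !mxE.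
  by rewrite subD !mxrowK linearP.
exists (fun r => [ffun i : I => c _ i (enum_rankK i) r : M i]) => [f|r].
  apply/ffunP => i; rewrite ffunE /c; move: (enum_rankK i).
  by move: (enum_rank i) => j e; case: i / e; rewrite /= mxrowK v2rK.
apply/mxrowP => j; rewrite mxrowK ffunE /c; move: (enum_rankK (enum_val j)).
move: (enum_rank _) => j' e; have ej := enum_val_inj e.
by subst j'; rewrite (eq_axiomK e) /= r2vK.
Qed.
HB.instance Definition _ := Lmodule_hasFinDim.Build k dprodv dprodv_vect_iso.

Definition dprodv_proj i (f : dprodv) : M i := f i.
Fact dprodv_proj_linear i : linear (@dprodv_proj i).
Proof. by move=> a f g; rewrite /dprodv_proj !ffunE. Qed.
HB.instance Definition _ i := GRing.isSemilinear.Build k dprodv (M i) _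
  (@dprodv_proj i) (GRing.semilinear_linear (@dprodv_proj_linear i)).

Definition dprodv_inj i (x : M i) : dprodv :=
  [ffun j : I => dfwith (fun j => 0 : M j) x j : M j].

Lemma dprodv_inj_linear i : linear (@dprodv_inj i).
Proof.
move=> a x y; apply/ffunP => j; rewrite !ffunE.
have [<-|ne] := eqVneq i j; first by rewrite !dfwith_in.
by rewrite !dfwith_out // scaler0 addr0.
Qed.
HB.instance Definition _ i := GRing.isSemilinear.Build k (M i) dprodv _
  (@dprodv_inj i) (GRing.semilinear_linear (@dprodv_inj_linear i)).

Lemma dprodv_sumE (J : Type) (s : seq J) (F : J -> dprodv) i :
  (\sum_(j <- s) F j) i = \sum_(j <- s) F j i.
Proof. exact: (linear_sum (@dprodv_proj i)). Qed.

Lemma dprodv_decomp f : f = \sum_i dprodv_inj (f i).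
Proof.
apply/ffunP => i; rewrite dprodv_sumE (bigD1 i) //= big1 => [|j ne].
  by rewrite addr0 ffunE dfwith_in.
by rewrite ffunE dfwith_out.
Qed.

Lemma dim_dprodv :
  \dim {: dprodv} = (\sum_i \dim {: M i})%N.
Proof.
rewrite dimvf /= (eq_bigr (fun i => dim (M i))) => [|i _].
  rewrite -[LHS](big_enum_val (fun i => dim (M i))).
  by apply: eq_bigl.
by rewrite dimvf.
Qed.

End DirectProduct.

Definition degree : Type := (int * int * int)%type.
HB.instance Definition _ := GRing.Zmodule.on degree.

(* A separate definition because [directv] looks through a transparent [F]
   that is itself a sum, and would then assert more. *)
Definition vdirect (k : fieldType) (vT : vectType k) (s : seq degree)
    (F : degree -> {vspace vT}) : Prop :=
  directv (\sum_(d <- s) F d).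

(* [gdegs] is any finite list of degrees outside of which the graded pieces
   vanish; it may contain degrees in which the piece is zero. *)
Record gspace (k : fieldType) := GSpace {
  gsort :> vectType k;
  gpart : degree -> {vspace gsort};
  gdegs : seq degree;
  gdegs_uniq : uniq gdegs;
  gpart_out : forall d, d \notin gdegs -> gpart d = 0%VS;
  gpart_direct : vdirect gdegs gpart;
  gpart_full : (\sum_(d <- gdegs) gpart d)%VS = fullv }.

Definition gisom (k : fieldType) (M N : gspace k) : Prop :=
  exists f : {linear M -> N},
    bijective f /\ forall d x, (x \in gpart M d) = (f x \in gpart N d).

Section GradedBasics.
Variable k : fieldType.

Lemma limg_dim_leq (vT wT : vectType k) (f : 'Hom(vT, wT)) U :
  (\dim (f @: U) <= \dim U)%N.
Proof. by rewrite -(limg_ker_dim f U) leq_addl. Qed.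

Lemma subv_big_sum (vT : vectType k) (s : seq degree) (P : pred degree)
    (F : degree -> {vspace vT}) W :
  (forall d, d \in s -> P d -> (F d <= W)%VS) ->
  (\sum_(d <- s | P d) F d <= W)%VS.
Proof.
move=> sFW; rewrite big_seq_cond.
elim/big_ind: _ => [|U1 U2 s1 s2|d /andP[]]; first exact: sub0v.
  by rewrite subv_add s1.
exact: sFW.
Qed.

Lemma subv_big_sup (vT : vectType k) (s : seq degree) (P : pred degree)
    (F : degree -> {vspace vT}) d :
  d \in s -> P d -> (F d <= \sum_(d <- s | P d) F d)%VS.
Proof. by move=> ds Pd; rewrite (big_rem d) //= Pd addvSl. Qed.

Lemma dim_gspace (M : gspace k) :
  \dim {: M} = (\sum_(d <- gdegs M) \dim (gpart M d))%N.
Proof.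
rewrite -(gpart_full M).
by have := gpart_direct M; rewrite /vdirect directvE /= => /eqP.
Qed.

Lemma gpart_direct_of_dim (vT : vectType k) (F : degree -> {vspace vT})
    (s : seq degree) :
  (\sum_(d <- s) F d)%VS = fullv ->
  (\sum_(d <- s) \dim (F d) <= \dim {: vT})%N ->
  vdirect s F.
Proof.
move=> full le; rewrite /vdirect directvE /= eqn_leq dimv_leq_sum /=.
by rewrite full.
Qed.

Lemma big_vanish_out (R : Type) (idx : R) (op : Monoid.com_law idx)
    (F : degree -> R) (s t : seq degree) :
  uniq s -> uniq t -> {subset t <= s} -> (forall d, d \notin t -> F d = idx) ->
  \big[op/idx]_(d <- s) F d = \big[op/idx]_(d <- t) F d.
Proof.
move=> us ut st F0; rewrite (bigID (mem t)) /= [X in op _ X]big1 // Monoid.mulm1.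
rewrite -big_filter; apply: perm_big; apply: uniq_perm => //.
  exact: filter_uniq.
by move=> d; rewrite mem_filter; case dt: (d \in t) => //=; rewrite st.
Qed.

Lemma gpart_full_sub (M : gspace k) s :
  uniq s -> {subset gdegs M <= s} -> (\sum_(d <- s) gpart M d)%VS = fullv.
Proof.
move=> us sub; rewrite -[RHS](gpart_full M); apply: big_vanish_out => //.
  exact: gdegs_uniq.
exact: gpart_out.
Qed.

Lemma dim_gspace_sub (M : gspace k) s :
  uniq s -> {subset gdegs M <= s} ->
  (\sum_(d <- s) \dim (gpart M d) = \dim {: M})%N.
Proof.
move=> us sub; rewrite dim_gspace; apply: big_vanish_out => //.
  exact: gdegs_uniq.
by move=> d /gpart_out ->; rewrite dimv0.
Qed.

Lemma memv_gspace (M : gspace k) (vT : vectType k) (f : {linear M -> vT})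
    (W : {vspace vT}) :
  (forall d x, d \in gdegs M -> x \in gpart M d -> f x \in W) ->
  forall x, f x \in W.
Proof.
move=> fW x; suff: x \in (linfun f @^-1: W)%VS by rewrite -memv_preim lfunE.
have: x \in (fullv : {vspace M}) by apply: memvf.
rewrite -(gpart_full M); apply/subvP/subv_big_sum => d ds _; apply/subvP => y yd.
by rewrite -memv_preim lfunE; apply: fW yd.
Qed.

End GradedBasics.

Section GroundField.
Variable k : fieldType.

Let part (d : degree) : {vspace k^o} := if d == 0 then fullv else 0%VS.
Let degs : seq degree := [:: 0].

Fact gground_out d : d \notin degs -> part d = 0%VS.
Proof. by rewrite inE /part => /negPf ->. Qed.
Fact gground_full : (\sum_(d <- degs) part d)%VS = fullv.
Proof. by rewrite big_seq1 /part eqxx. Qed.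
Fact gground_direct : vdirect degs part.
Proof.
apply: gpart_direct_of_dim; first exact: gground_full.
by rewrite big_seq1 /part eqxx.
Qed.

Definition gground : gspace k :=
  @GSpace k k^o part degs isT gground_out gground_direct gground_full.

End GroundField.

Section Shift.
Variables (k : fieldType) (M : gspace k) (s : degree).

Let part (d : degree) : {vspace M} := gpart M (d - s).
Let degs := [seq d + s | d <- gdegs M].

Fact gshift_uniq : uniq degs.
Proof. by rewrite map_inj_uniq ?gdegs_uniq //; apply: addIr. Qed.
Fact gshift_out d : d \notin degs -> part d = 0%VS.
Proof.
move=> dn; apply: gpart_out; apply: contra dn => dM.
by apply/mapP; exists (d - s); rewrite // subrK.
Qed.
Fact gshift_full : (\sum_(d <- degs) part d)%VS = fullv.
Proof.
rewrite big_map -[RHS](gpart_full M); apply: eq_bigr => d _.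
by rewrite /part addrK.
Qed.
Fact gshift_direct : vdirect degs part.
Proof.
apply: gpart_direct_of_dim; first exact: gshift_full.
by rewrite big_map dim_gspace leq_sum // => d _; rewrite /part addrK.
Qed.

Definition gshift : gspace k :=
  GSpace gshift_uniq gshift_out gshift_direct gshift_full.

End Shift.

Section DirectSum.
Variables (k : fieldType) (I : finType) (M : I -> gspace k).

Let V := dprodv (fun i => gsort (M i)).

Definition gdsum_part (d : degree) : {vspace V} :=
  (\bigcap_i (linfun (dprodv_proj i) @^-1: gpart (M i) d))%VS.

Lemma mem_gdsum_part d (f : V) :
  reflect (forall i, f i \in gpart (M i) d) (f \in gdsum_part d).
Proof.
apply: (iffP subv_bigcapP) => fM i => [|_].
  by have := fM i isT; rewrite -!memvE -memv_preim lfunE.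
by rewrite -!memvE -memv_preim lfunE; apply: fM.
Qed.

Let part_sum d :
  gdsum_part d = (\sum_i linfun (@dprodv_inj k I M i) @: gpart (M i) d)%VS.
Proof.
apply/vspaceP => f; apply/mem_gdsum_part/idP => [fM | ].
  rewrite [f]dprodv_decomp; apply: memv_sumr => i _.
  by apply/memv_imgP; exists (f i); rewrite ?lfunE.
case/memv_sumP => g gM -> i; rewrite dprodv_sumE.
apply: memv_suml => j _; have /memv_imgP[x xM ->] := gM j isT.
rewrite lfunE /= ffunE; have [eji | ne] := eqVneq j i.
  by case: i / eji; rewrite dfwith_in.
by rewrite dfwith_out // mem0v.
Qed.

Let degs := undup (flatten [seq gdegs (M i) | i <- enum I]).

Let sub_degs i : {subset gdegs (M i) <= degs}.
Proof.
move=> d dM; rewrite mem_undup; apply/flattenP; exists (gdegs (M i)) => //.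
by apply: map_f; rewrite mem_enum.
Qed.

Fact gdsum_uniq : uniq degs. Proof. exact: undup_uniq. Qed.
Fact gdsum_out d : d \notin degs -> gdsum_part d = 0%VS.
Proof.
move=> dn; rewrite part_sum big1 // => i _; rewrite gpart_out ?limg0 //.
by apply: contra dn; apply: sub_degs.
Qed.
Fact gdsum_full : (\sum_(d <- degs) gdsum_part d)%VS = fullv.
Proof.
rewrite (eq_bigr _ (fun d _ => part_sum d)) exchange_big /=.
apply/eqP; rewrite eqEsubv subvf; apply/subvP => f _.
rewrite [f]dprodv_decomp; apply: memv_sumr => i _.
rewrite -limg_sum (gpart_full_sub gdsum_uniq (@sub_degs i)).
by apply/memv_imgP; exists (f i); rewrite ?memvf ?lfunE.
Qed.
Fact gdsum_direct : vdirect degs gdsum_part.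
Proof.
apply: gpart_direct_of_dim; first exact: gdsum_full.
rewrite dim_dprodv.
apply: (@leq_trans (\sum_(d <- degs) \sum_i \dim (gpart (M i) d))%N).
  apply: leq_sum => d _; rewrite part_sum (leq_trans (dimv_leq_sum _ _ _)) //.
  by apply: leq_sum => i _; apply: limg_dim_leq.
rewrite exchange_big /= leq_sum // => i _.
by rewrite (dim_gspace_sub gdsum_uniq (@sub_degs i)).
Qed.

Definition gdsum : gspace k :=
  GSpace gdsum_uniq gdsum_out gdsum_direct gdsum_full.

End DirectSum.

Section Tensor.
Variables (k : fieldType) (M N : vectType k).

(* The tensor product of two finite-dimensional spaces, realised on the
   matrices of coordinates in the chosen bases; [outer_universal] is its
   universal property. *)
Definition tensv : vectType k := 'M[k]_(\dim {: M}, \dim {: N}).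

Definition outer (x : M) (y : N) : tensv :=
  \matrix_(i, j) (coord (vbasis fullv) i x * coord (vbasis fullv) j y).

Lemma outer_linear_r x : linear (outer x).
Proof.
move=> a y z; apply/matrixP => i j; rewrite !mxE linearP /=.
by rewrite mulrDr mulrCA.
Qed.
HB.instance Definition _ x := GRing.isSemilinear.Build k N tensv _
  (outer x) (GRing.semilinear_linear (outer_linear_r x)).

Definition outerl y x := outer x y.
Lemma outer_linear_l y : linear (outerl y).
Proof.
move=> a x z; apply/matrixP => i j; rewrite !mxE linearP /=.
by rewrite mulrDl mulrA.
Qed.
HB.instance Definition _ y := GRing.isSemilinear.Build k M tensv _
  (outerl y) (GRing.semilinear_linear (outer_linear_l y)).

Lemma outer_decomp (A : tensv) :
  A = \sum_i \sum_j
        A i j *: outer (vbasis fullv)`_i (vbasis fullv)`_j.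
Proof.
rewrite [LHS]matrix_sum_delta; apply: eq_bigr => i _; apply: eq_bigr => j _.
congr (_ *: _); apply/matrixP => i' j'; rewrite !mxE.
by rewrite !coord_free ?(basis_free (vbasisP _)) // -natrM mulnb eq_sym
  (eq_sym j').
Qed.

Lemma outer_universal (P : vectType k) (f : M -> N -> P) :
  (forall x, linear (f x)) -> (forall y, linear (f^~ y)) ->
  exists! g : 'Hom(tensv, P), forall x y, g (outer x y) = f x y.
Proof.
move=> fr fl.
pose fr' x : {linear N -> P} := HB.pack (f x)
  (GRing.isSemilinear.Build k N P _ (f x) (GRing.semilinear_linear (fr x))).
pose fl' y : {linear M -> P} := HB.pack (f^~ y)
  (GRing.isSemilinear.Build k M P _ (f^~ y) (GRing.semilinear_linear (fl y))).
pose e i : M := (vbasis fullv)`_i; pose e' j : N := (vbasis fullv)`_j.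
pose g0 (A : tensv) : P := \sum_i \sum_j A i j *: f (e i) (e' j).
have g0l : linear g0.
  move=> a A B; rewrite /g0 scaler_sumr -big_split; apply: eq_bigr => i _.
  rewrite scaler_sumr -big_split; apply: eq_bigr => j _ /=.
  by rewrite !mxE scalerDl scalerA.
pose g' : {linear tensv -> P} := HB.pack g0
  (GRing.isSemilinear.Build k tensv P _ g0 (GRing.semilinear_linear g0l)).
exists (linfun g'); split=> [x y|h hf].
  rewrite lfunE /= /g0 -[RHS]/(fl' y x) [in RHS](coord_vbasis (memvf x)).
  rewrite linear_sum; apply: eq_bigr => i _.
  rewrite linearZ /= -[f _ y]/(fr' (e i) y) [in RHS](coord_vbasis (memvf y)).
  rewrite linear_sum.
  rewrite scaler_sumr; apply: eq_bigr => j _.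
  by rewrite mxE linearZ /= scalerA.
apply/lfunP => A; rewrite lfunE [in RHS](outer_decomp A) linear_sum.
apply: eq_bigr => i _; rewrite linear_sum; apply: eq_bigr => j _.
by rewrite linearZ /= hf.
Qed.

Definition tprodv (U : {vspace M}) (W : {vspace N}) : {vspace tensv} :=
  <<[seq outer x y | x <- vbasis U, y <- vbasis W]>>%VS.

Lemma mem_tprodv (U : {vspace M}) (W : {vspace N}) x y :
  x \in U -> y \in W -> outer x y \in tprodv U W.
Proof.
move=> xU yW; rewrite -[outer x y]/(outerl y x) (coord_vbasis xU) linear_sum.
apply: memv_suml => i _; rewrite linearZ /= memvZ // /outerl.
rewrite (coord_vbasis yW) linear_sum; apply: memv_suml => j _.
rewrite linearZ /= memvZ // memv_span // allpairs_f //.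
  by apply: mem_nth; rewrite size_tuple.
by apply: mem_nth; rewrite size_tuple.
Qed.

Lemma dim_tprodv_leq U W : (\dim (tprodv U W) <= \dim U * \dim W)%N.
Proof. by rewrite (leq_trans (dim_span _)) // size_allpairs !size_tuple. Qed.

End Tensor.

Section GradedTensor.
Variables (k : fieldType) (M N : gspace k).

Definition gtens_part (d : degree) : {vspace tensv M N} :=
  (\sum_(a <- gdegs M) \sum_(b <- gdegs N | (a + b)%R == d)
     tprodv (gpart M a) (gpart N b))%VS.

Let degs := undup [seq a + b | a <- gdegs M, b <- gdegs N].

Fact gtens_uniq : uniq degs. Proof. exact: undup_uniq. Qed.
Fact gtens_out d : d \notin degs -> gtens_part d = 0%VS.
Proof.
move=> dn; rewrite /gtens_part big1_seq // => a /= aM.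
rewrite big1_seq // => b /= /andP[/eqP dE bN].
by case/negP: dn; rewrite mem_undup -dE allpairs_f.
Qed.
Fact gtens_full : (\sum_(d <- degs) gtens_part d)%VS = fullv.
Proof.
apply/eqP; rewrite eqEsubv subvf; apply/subvP => A _.
rewrite (outer_decomp A); apply: memv_suml => i _; apply: memv_suml => j _.
rewrite memvZ //; move: (_`_i) (_`_j) => x y.
rewrite -/(outerl y x); apply: memv_gspace x => a x aM xa.
rewrite /outerl; apply: memv_gspace y => b y bN yb.
have dab : a + b \in degs by rewrite mem_undup allpairs_f.
have s1 := subv_big_sup gtens_part dab (erefl : predT (a + b)).
pose F a' := (\sum_(b' <- gdegs N | (a' + b')%R == (a + b)%R)
  tprodv (gpart M a') (gpart N b'))%VS.
have s2 := subv_big_sup F aM (erefl : predT a).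
have s3 := subv_big_sup (P := fun b' => a + b' == a + b)
  (fun b' => tprodv (gpart M a) (gpart N b')) bN (eqxx _).
apply: (subvP s1); apply: (subvP s2); apply: (subvP s3).
exact: mem_tprodv.
Qed.
Fact gtens_direct : vdirect degs gtens_part.
Proof.
apply: gpart_direct_of_dim; first exact: gtens_full.
have -> : \dim {: tensv M N} = (\dim {: M} * \dim {: N})%N by rewrite dimvf.
apply: (@leq_trans (\sum_(d <- degs) \sum_(a <- gdegs M)
    \sum_(b <- gdegs N | (a + b)%R == d)
       \dim (gpart M a) * \dim (gpart N b))%N).
  apply: leq_sum => d _; rewrite (leq_trans (dimv_leq_sum _ _ _)) //.
  apply: leq_sum => a _; rewrite (leq_trans (dimv_leq_sum _ _ _)) //.
  by apply: leq_sum => b _; apply: dim_tprodv_leq.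
rewrite !dim_gspace big_distrl exchange_big /=; apply: leq_sum => a _.
rewrite big_distrr (exchange_big_dep predT) //=; apply: leq_sum => b _.
rewrite big_const_seq iter_addn_0 -[leqRHS]muln1 leq_mul2l.
rewrite (eq_count (a2 := pred1 (a + b))) => [|d]; last by rewrite /= eq_sym.
by rewrite count_uniq_mem ?gtens_uniq // leq_b1 orbT.
Qed.

Definition gtens : gspace k :=
  GSpace gtens_uniq gtens_out gtens_direct gtens_full.

End GradedTensor.

Definition kshift (k : fieldType) (d : degree) : gspace k :=
  gshift (gground k) d.

(* Finite graphs with loops and multiple edges, with vertices and edges taken
   in ambient finite types so that vertex and edge sets of different graphs
   may be compared.  The set of ends of a loop is a singleton; the value of
   [ends] outside of [eset] is irrelevant. *)
Record graph (V E : finType) := Graph {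
  vset : {set V};
  eset : {set E};
  ends : E -> {set V};
  ends_vset : forall e, e \in eset -> ends e \subset vset;
  card_ends : forall e, e \in eset -> (0 < #|ends e| <= 2)%N }.

Definition is_union (V E : finType) (G K H : graph V E) (U : {set V}) : Prop :=
  [/\ vset G = vset K :|: vset H, vset K :&: vset H = U &
   [/\ eset G = eset K :|: eset H, [disjoint eset K & eset H],
       {in eset K, ends G =1 ends K} & {in eset H, ends G =1 ends H}]].

Section Components.
Variables (V E : finType) (G : graph V E).

Definition adj (S : {set E}) : rel V :=
  fun x y => [exists e in S, ends G e == [set x; y]].

Definition omega (S : {set E}) : nat := n_comp (adj S) (vset G).

Definition boundary (U : {set V}) (S : {set E}) : {set {set V}} :=
  equivalence_partition (connect (adj S)) U.

Lemma connect_adj_equiv S : equivalence_rel (connect (adj S)).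
Proof.
apply/equivalence_relP; split=> [x|x y]; first exact: connect0.
apply/same_connect/sym_connect_sym => {}x {}y.
by apply: eq_existsb => e; rewrite setUC.
Qed.

Lemma boundary_partition U S : partition (boundary U S) U.
Proof. by apply: equivalence_partitionP => x y z *; apply: connect_adj_equiv. Qed.

End Components.

Definition Pi (V : finType) (U : {set V}) : finType :=
  {P : {set {set V}} | partition P U}.

Section Join.
Variables (V : finType) (U : {set V}).

Definition join_rel (P Q : {set {set V}}) : rel V :=
  connect (fun x y => (y \in pblock P x) || (y \in pblock Q x)).

Lemma join_rel_smallest (p q : Pi U) (P := val p) (Q := val q) :
  [/\ {in U & &, equivalence_rel (join_rel P Q)},
      {in U &, forall x y, y \in pblock P x -> join_rel P Q x y},
      {in U &, forall x y, y \in pblock Q x -> join_rel P Q x y} &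
      forall R : rel V, {in U & &, equivalence_rel R} ->
        {in U &, forall x y, y \in pblock P x -> R x y} ->
        {in U &, forall x y, y \in pblock Q x -> R x y} ->
        {in U &, forall x y, join_rel P Q x y -> R x y}].
Proof.
have pP : partition P U := valP p; have pQ : partition Q U := valP q.
have pbU r x y : partition r U -> y \in pblock r x -> (x \in U) * (y \in U).
  move=> /and3P[/eqP <- _ _]; rewrite /pblock.
  case: pickP => [B /andP[/= rB Bx] By | _ /=]; last by rewrite inE.
  by split; apply/bigcupP; exists B.
have pbC r x y : partition r U -> (y \in pblock r x) = (x \in pblock r y).
  move=> pr; have /and3P[/eqP covr tr _] := pr.
  by apply/idP/idP => h; rewrite (same_pblock tr h) mem_pblock covr;
    have [] := pbU _ _ _ pr h.
split.
- suff h : equivalence_rel (join_rel P Q) by move=> x y z _ _ _; apply: h.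
  apply/equivalence_relP; split=> [x|x y]; first exact: connect0.
  by apply/same_connect/sym_connect_sym => {}x {}y; rewrite (pbC P) // (pbC Q).
- by move=> x y _ _ h; apply: connect1; rewrite h.
- by move=> x y _ _ h; apply: connect1; rewrite h orbT.
move=> R Req PR QR x y xU yU /connectP[s].
elim: s x xU => [|z s IHs] x xU /= => [_ -> | /andP[xz zs] ylast].
  by have [] := Req x x x xU xU xU.
have zU : z \in U by case/orP: xz => [/(pbU _ _ _ pP)|/(pbU _ _ _ pQ)] [].
have Rxz : R x z by case/orP: xz; [apply: PR | apply: QR].
have [_ /(_ Rxz) ->] := Req x z y xU zU yU.
exact: IHs.
Qed.

Definition rho (p q : Pi U) : nat :=
  #|equivalence_partition (join_rel (val p) (val q)) U|.

End Join.

Section GraphSpaces.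
Variables (k : fieldType) (V E : finType).
Implicit Types (G K : graph V E) (U : {set V}).

Definition N0 G : gspace k :=
  gdsum (fun S : {S : {set E} | S \subset eset G} =>
    kshift k ((omega G (val S))%:Z, #|val S|%:Z,
              #|eset G|%:Z - #|val S|%:Z)).

Definition NU U (p : Pi U) K : gspace k :=
  gdsum (fun S : {S : {set E} |
                   (S \subset eset K) && (boundary K U S == val p)} =>
    kshift k ((omega K (val S))%:Z - #|val p|%:Z, #|val S|%:Z,
              #|eset K|%:Z - #|val S|%:Z)).

End GraphSpaces.

(* Main.v *)
Require Import Defs.
From HB Require Import structures.
From mathcomp Require Import all_boot all_order all_algebra.
From mathcomp Require Import zify.

(** A finite-dimensional graded space is determined up to isomorphism by the
    dimensions of its graded pieces ([gisom_of_dim]), and both sides have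
    homogeneous bases indexed by sets of edges.  On the left a basis vector is
    a set of edges S of G.  On the right it is a pair of partitions p, q
    together with sets of edges A of K and B of H inducing p and q on U; since
    A and B determine p and q, it is just a pair (A, B).  As the edges of G are
    those of K and of H, the union map sends such pairs bijectively to the sets
    S, and it remains to compare degrees.

    The second and third components of the degree count edges, so they are
    additive.  For the first component one has to show
<<
      omega_G (A :|: B) = (omega_K A - |p|) + rho p q + (omega_H B - |q|)
>>
    ([omega_union]).  Sort the components of a spanning subgraph by whether
    they meet U.  Those that meet U correspond to the blocks of the boundary
    partition ([omega_boundary]), so omega_K A - |p| is the number of components
    of (K, A) that avoid U, and similarly for H.  A component that avoids U
    cannot pass from K to H, so the components of (G, A :|: B) avoiding U are
    those of (K, A) together with those of (H, B) ([free_components_union]).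
    Finally a walk in G between vertices of U can only change sides in U, hence
    connectedness of vertices of U in (G, A :|: B) is the join of the two
    boundary relations ([connect_union]), and rho p q counts the components of
    (G, A :|: B) that meet U. *)

Set Implicit Arguments.
Unset Strict Implicit.
Unset Printing Implicit Defensive.

Import GRing.Theory.
Local Open Scope ring_scope.

(** * Graded spaces with equal graded dimensions *)

Section VbasisMap.
Variables (k : fieldType) (vT wT : vectType k).
Variables (U : {vspace vT}) (W : {vspace wT}).

(** The linear map that sends the chosen basis of U to that of W entry by entry;
    entries of the basis of U beyond the dimension of W are sent to 0. *)
Definition vbasis_map_fun (x : vT) : wT :=
  \sum_(i < \dim U) coord (vbasis U) i x *: (vbasis W)`_i.

Fact vbasis_map_linear : linear vbasis_map_fun.
Proof.
move=> a x y; rewrite /vbasis_map_fun scaler_sumr -big_split.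
by apply: eq_bigr => i _; rewrite linearP scalerDl scalerA.
Qed.
HB.instance Definition _ := GRing.isSemilinear.Build k vT wT _
  vbasis_map_fun (GRing.semilinear_linear vbasis_map_linear).

Definition vbasis_map : 'Hom(vT, wT) := linfun vbasis_map_fun.

Lemma vbasis_map_nth j : (j < \dim U)%N ->
  vbasis_map (vbasis U)`_j = (vbasis W)`_j.
Proof.
move=> ltj; rewrite lfunE /= /vbasis_map_fun (bigD1 (Ordinal ltj)) //=.
rewrite (coord_free (Ordinal ltj)) ?(basis_free (vbasisP U)) // eqxx scale1r.
rewrite big1 ?addr0 // => i ne.
rewrite (coord_free (Ordinal ltj)) ?(basis_free (vbasisP U)) //.
by rewrite eq_sym (negPf ne) scale0r.
Qed.

Lemma vbasis_map_mem x : vbasis_map x \in W.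
Proof.
rewrite lfunE; apply: memv_suml => i _; rewrite memvZ //.
have [ltiW | geW] := ltnP i (\dim W).
  by rewrite vbasis_mem // mem_nth // size_tuple.
by rewrite nth_default ?mem0v // size_tuple.
Qed.

End VbasisMap.

Lemma vbasis_mapK (k : fieldType) (vT wT : vectType k)
    (U : {vspace vT}) (W : {vspace wT}) x :
  \dim U = \dim W -> x \in U -> vbasis_map W U (vbasis_map U W x) = x.
Proof.
move=> eqUW xU; rewrite [in RHS](coord_vbasis xU) {1}(coord_vbasis xU).
rewrite !linear_sum; apply: eq_bigr => i _; rewrite !linearZ /=.
by rewrite !vbasis_map_nth // -eqUW.
Qed.

Section Graded.
Variable k : fieldType.
Implicit Types M N : gspace k.

(** A graded space is the direct sum of its pieces, so linear maps prescribed
    on each piece glue: project onto each of the finitely many nonzero pieces,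
    apply the prescribed map, and add up. *)
Lemma gspace_glue M (vT : vectType k) (g : degree -> 'Hom(M, vT)) :
  exists f : 'Hom(M, vT), forall d x, x \in gpart M d -> f x = g d x.
Proof.
pose t := in_tuple (gdegs M); pose W i := gpart M (tnth t i).
have full : (\sum_i W i)%VS = fullv.
  by rewrite -(gpart_full M) (big_tnth _ _ (gdegs M)).
have dir : directv (\sum_i W i).
  have := gpart_direct M; rewrite /vdirect !directvE /=.
  by rewrite !(big_tnth _ _ (gdegs M)).
pose p i := sumv_pi (\sum_i W i)%VS i.
exists (\sum_i (g (tnth t i) \o p i)%VF) => d x xd.
have [dM | /gpart_out Md0] := boolP (d \in gdegs M); last first.
  by move: xd; rewrite Md0 memv0 => /eqP->; rewrite !linear0.
have [j dj] : exists j, d = tnth t j.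
  have: d \in t by [].
  by case/tnthP=> j ->; exists j.
(* The decomposition of x with x at place j and 0 elsewhere is the one
   given by the projections, because the sum is direct. *)
have pE i : p i x = if i == j then x else 0.
  have psum : \sum_i p i x = x.
    by apply: sumv_pi_uniq_sum; rewrite ?full ?memvf ?filter_predT ?index_enum_uniq.
  have xsum : \sum_(i : 'I_(size (gdegs M))) (if i == j then x else 0) = x.
    by rewrite -big_mkcond big_pred1_eq.
  have /directv_sum_unique/(_ (p^~ x) (fun i => if i == j then x else 0)) := dir.
  rewrite psum xsum eqxx => h.
  have /forallP/(_ i)/eqP // : [forall i, p i x == if i == j then x else 0].
  symmetry; apply: h => l _; first exact: memv_sum_pi.
  by case: eqP => [->|_]; rewrite ?mem0v // /W -dj.
rewrite sum_lfunE (bigD1 j) //= comp_lfunE pE eqxx -dj big1 ?addr0 // => i ne.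
by rewrite comp_lfunE pE (negPf ne) linear0.
Qed.

Lemma gspace_lfun_ext M (vT : vectType k) (f g : 'Hom(M, vT)) :
  (forall d x, x \in gpart M d -> f x = g x) -> f = g.
Proof.
move=> fg; apply/lfunP => x; apply/eqP; rewrite -subr_eq0.
have -> : f x - g x = (f - g) x by rewrite add_lfunE opp_lfunE.
rewrite -memv0; apply: (memv_gspace (f := f - g)) => d {}x _ xd.
by rewrite memv0 /= add_lfunE opp_lfunE subr_eq0 (fg d).
Qed.

(** Glue, over all degrees, the maps matching the chosen bases of the two
    pieces.  The same construction in the other direction is inverse to it, as
    can be checked on homogeneous vectors. *)
Lemma gisom_of_dim M N :
  (forall d, \dim (gpart M d) = \dim (gpart N d)) -> gisom M N.
Proof.
move=> eqMN.
have [f fE] := gspace_glue (fun d => vbasis_map (gpart M d) (gpart N d)).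
have [g gE] := gspace_glue (fun d => vbasis_map (gpart N d) (gpart M d)).
have fM d x : x \in gpart M d -> f x \in gpart N d.
  by move=> xd; rewrite (fE d) ?vbasis_map_mem.
have gN d y : y \in gpart N d -> g y \in gpart M d.
  by move=> yd; rewrite (gE d) ?vbasis_map_mem.
have fK : cancel f g.
  move=> x; rewrite -comp_lfunE -[RHS]id_lfunE; congr (fun_of_lfun _ x).
  apply: gspace_lfun_ext => d {}x xd; rewrite comp_lfunE id_lfunE.
  by rewrite (gE d) ?fM // (fE d) // vbasis_mapK.
have gK : cancel g f.
  move=> y; rewrite -comp_lfunE -[RHS]id_lfunE; congr (fun_of_lfun _ y).
  apply: gspace_lfun_ext => d {}y yd; rewrite comp_lfunE id_lfunE.
  by rewrite (fE d) ?gN // (gE d) // vbasis_mapK.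
exists f; split; first by exists g.
by move=> d x; apply/idP/idP => [/fM // | /gN]; rewrite fK.
Qed.

(** * Graded dimensions of shifts, sums and tensor products *)

(** An upper bound for each graded dimension is attained everywhere as soon as
    it does not exceed the dimension of the whole space in total.  For direct
    sums and tensor products the upper bounds come from spanning sets, which
    avoids any independence argument. *)
Lemma dim_gpart_squeeze M (c : degree -> nat) (s : seq degree) d :
    uniq s -> {subset gdegs M <= s} -> d \in s ->
    (forall e, \dim (gpart M e) <= c e)%N ->
    (\sum_(e <- s) c e <= \dim {: M})%N ->
  \dim (gpart M d) = c d.
Proof.
move=> us sMs ds le_c; rewrite -(dim_gspace_sub us sMs) !(big_rem d ds) /=.
move=> le_sum; apply/eqP; rewrite eqn_leq le_c /=.
rewrite -(leq_add2r (\sum_(e <- rem d s) c e)) (leq_trans le_sum) //.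
by rewrite leq_add2l leq_sum.
Qed.

Lemma sum_eq_mul (s : seq degree) x (F : degree -> nat) :
  uniq s -> x \in s -> (\sum_(a <- s) (x == a) * F a = F x)%N.
Proof.
move=> us xs; rewrite (bigD1_seq x) //= eqxx mul1n big1 ?addn0 // => a ne.
by rewrite eq_sym (negPf ne).
Qed.

(** The numerical form of: M has a homogeneous basis indexed by I in which the
    vector of index i has degree u i. *)
Definition has_degrees M (I : finType) (u : I -> degree) :=
  forall d, \dim (gpart M d) = (\sum_i (u i == d))%N.

Lemma has_degrees_mem M (I : finType) (u : I -> degree) i :
  has_degrees M u -> u i \in gdegs M.
Proof.
move=> Mu; apply/negPn/negP => /gpart_out Mi0; have := Mu (u i).
by rewrite Mi0 dimv0 (bigD1 i) //= eqxx.
Qed.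

Lemma has_degrees_card M (I : finType) (u : I -> degree) :
  has_degrees M u -> \dim {: M} = #|I|.
Proof.
move=> Mu; rewrite dim_gspace (eq_bigr _ (fun d _ => Mu d)) exchange_big /=.
rewrite -sum1_card; apply: eq_bigr => i _.
rewrite -[RHS](sum_eq_mul (fun=> 1%N) (gdegs_uniq M) (has_degrees_mem i Mu)).
by apply: eq_bigr => d _; rewrite muln1.
Qed.

Lemma has_degrees_kshift d : has_degrees (kshift k d) (fun _ : unit => d).
Proof.
move=> e; rewrite (big_pred1 tt) => [/=|[] //].
rewrite subr_eq0 eq_sym; case: eqP => _; last by rewrite dimv0.
by rewrite dimvf.
Qed.

Lemma has_degrees_gtens M N (I J : finType) (u : I -> degree) (v : J -> degree) :
  has_degrees M u -> has_degrees N v ->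
  has_degrees (gtens M N) (fun ij : I * J => u ij.1 + v ij.2).
Proof.
move=> Mu Nv d; pose c e := (\sum_(ij : I * J) ((u ij.1 + v ij.2)%R == e))%N.
pose s := undup
  (d :: gdegs (gtens M N) ++ codom (fun ij : I * J => u ij.1 + v ij.2)).
apply: (@dim_gpart_squeeze _ c s); rewrite ?undup_uniq //.
- by move=> e eMN; rewrite mem_undup inE mem_cat eMN orbT.
- by rewrite mem_undup inE eqxx.
- move=> e; rewrite /= /gtens_part; apply: leq_trans (dimv_leq_sum _ _ _) _.
  (* Expand the products of dimensions into sums over I and J.  For given i
     and j the only nonzero term is the one with a = u i and b = v j. *)
  apply: (@leq_trans (\sum_(a <- gdegs M) \sum_(b <- gdegs N)
     \sum_i \sum_j (u i == a) * ((v j == b) * ((a + b)%R == e)))%N).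
    apply: leq_sum => a _; apply: leq_trans (dimv_leq_sum _ _ _) _.
    rewrite big_mkcond; apply: leq_sum => b _ /=.
    case: ifP => _; last by [].
    apply: leq_trans (dim_tprodv_leq _ _) _; rewrite Mu Nv big_distrlr /=.
    by apply: leq_sum => i _; apply: leq_sum => j _; rewrite muln1.
  rewrite (eq_bigr _ (fun a _ => exchange_big _ _ _ _ _ _)) exchange_big /=.
  rewrite /c -(pair_bigA _ (fun i j => (u i + v j == e) : nat)).
  apply: leq_sum => i _.
  rewrite (eq_bigr _ (fun a _ => exchange_big _ _ _ _ _ _)) exchange_big /=.
  apply: leq_sum => j _.
  rewrite -(sum_eq_mul (fun a => (a + v j == e) : nat)
    (gdegs_uniq M) (has_degrees_mem i Mu)).
  apply: leq_sum => a _; rewrite -big_distrr leq_mul2l; apply/orP; right.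
  by rewrite (sum_eq_mul (fun b => (a + b == e) : nat))
    ?gdegs_uniq ?has_degrees_mem.
rewrite exchange_big dimvf /= /dim /= (has_degrees_card Mu) (has_degrees_card Nv).
rewrite -card_prod -sum1_card; apply: leq_sum => ij _.
rewrite -[leqRHS](@sum_eq_mul s (u ij.1 + v ij.2) (fun=> 1%N)) ?undup_uniq //.
  by apply: leq_sum => e _; rewrite muln1.
by rewrite mem_undup inE mem_cat codom_f !orbT.
Qed.

Lemma dim_gpart_gdsum (I : finType) (M : I -> gspace k) d :
  \dim (gpart (gdsum M) d) = (\sum_i \dim (gpart (M i) d))%N.
Proof.
pose s := undup
  (d :: gdegs (gdsum M) ++ flatten [seq gdegs (M i) | i <- enum I]).
have sMs i : {subset gdegs (M i) <= s}.
  move=> e eM; rewrite mem_undup inE mem_cat; apply/orP; right; apply/orP; right.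
  by apply/flattenP; exists (gdegs (M i)) => //; apply: map_f; rewrite mem_enum.
apply: (@dim_gpart_squeeze _ (fun e => (\sum_i \dim (gpart (M i) e))%N) s);
  rewrite ?undup_uniq //.
- by move=> e eM; rewrite mem_undup inE mem_cat eM orbT.
- by rewrite mem_undup inE eqxx.
- move=> e; apply: (@leq_trans
    (\dim (\sum_i linfun (@dprodv_inj k I M i) @: gpart (M i) e)%VS)).
    apply: dimvS; apply/subvP => f /mem_gdsum_part fM.
    rewrite [f]dprodv_decomp; apply: memv_sumr => i _.
    by apply/memv_imgP; exists (f i); rewrite ?lfunE.
  apply: leq_trans (dimv_leq_sum _ _ _) _.
  by apply: leq_sum => i _; apply: limg_dim_leq.
rewrite dim_dprodv exchange_big /= leq_sum // => i _.
by rewrite (dim_gspace_sub _ (sMs i)) ?undup_uniq.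
Qed.

Lemma has_degrees_gdsum_kshift (I : finType) (u : I -> degree) :
  has_degrees (gdsum (fun i => kshift k (u i))) u.
Proof.
move=> d; rewrite dim_gpart_gdsum; apply: eq_bigr => i _.
by rewrite has_degrees_kshift (big_pred1 tt) // => -[].
Qed.

End Graded.

(** * Counting classes of an equivalence relation *)

Section EquivalenceClasses.
Variable T : finType.
Implicit Types (R e : rel T) (A U B : {set T}).
Local Open Scope nat_scope.

Lemma eq_equivalence_partition R1 R2 A :
  {in A &, R1 =2 R2} -> equivalence_partition R1 A = equivalence_partition R2 A.
Proof.
move=> eqR; apply: eq_in_imset => x xA; apply/setP => y; rewrite !inE.
by case yA: (y \in A) => //=; apply: eqR.
Qed.

(** The roots in A represent the connectedness classes of A, because the root
    of a vertex of the closed set A lies in A again. *)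
Lemma n_comp_equivalence_partition e A :
  connect_sym e -> closed e A ->
  n_comp e A = #|equivalence_partition (connect e) A|.
Proof.
move=> sym_e clA; have rootA x : x \in A -> fingraph.root e x \in A.
  by rewrite (closed_connect clA (connect_root e x)).
transitivity
  #|[set [set y in A | connect e x y] | x in predI (roots e) (mem A)]|.
  rewrite card_in_imset // => x y; rewrite !inE /= => /andP[rx xA] /andP[ry yA].
  move/setP/(_ y); rewrite !inE yA connect0 /= -(root_connect sym_e).
  by rewrite (eqP rx) (eqP ry) => /eqP.
congr #|pred_of_set _|; apply/setP => B; apply/imsetP/imsetP => -[x xA ->].
  by exists x => //; case/andP: xA.
exists (fingraph.root e x); first by rewrite inE /= roots_root //= rootA.
apply/setP => y; rewrite !inE; congr (_ && _).
exact: (same_connect sym_e (connect_root e x)).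
Qed.

(** Intersecting with U is a bijection from the classes of A that meet U to the
    classes of U. *)
Lemma card_equivalence_partition_sub R A U :
    equivalence_rel R -> U \subset A ->
  #|equivalence_partition R A| =
    (#|equivalence_partition R U| +
     #|[set B in equivalence_partition R A | [disjoint B & U]]|)%N.
Proof.
move=> eqR sUA; pose D := [set B : {set T} | [disjoint B & U]].
have Rxx x : R x x by have [] := eqR x x x.
have Rtr x y z : R x y -> R x z = R y z by have [_] := eqR x y z; apply.
rewrite -(cardsID D) addnC; congr (_ + _)%N; last first.
  by apply: eq_card => B; rewrite !inE.
have trace x : x \in U ->
    [set y in A | R x y] :&: U = [set y in U | R x y].
  move=> xU; apply/setP => y; rewrite !inE.
  by case yU: (y \in U); rewrite ?andbF // (subsetP sUA) // andbT.
have meetP B : B \in equivalence_partition R A :\: D ->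
    exists2 x, x \in U & B = [set y in A | R x y].
  case/setDP => /imsetP[x xA ->]; rewrite inE => /pred0Pn[y /=].
  rewrite !inE => /andP[/andP[yA Rxy] yU]; exists y => //.
  by apply/setP => z; rewrite !inE (Rtr x y).
rewrite -(card_in_imset (f := fun B => B :&: U)).
  congr #|pred_of_set _|; apply/setP => C; apply/imsetP/imsetP.
    by case=> B /meetP[x xU ->] ->; exists x; rewrite ?trace.
  case=> x xU ->; exists [set y in A | R x y]; last by rewrite trace.
  rewrite inE; apply/andP; split; last first.
    by apply/imsetP; exists x; rewrite ?(subsetP sUA).
  by rewrite inE; apply/pred0Pn; exists x; rewrite /= !inE (subsetP sUA) ?Rxx.
move=> B C /meetP[x xU ->] /meetP[y yU ->]; rewrite !trace // => /setP/(_ y).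
rewrite !inE yU Rxx /= => Rxy.
by apply/setP => z; rewrite !inE (Rtr x y).
Qed.

End EquivalenceClasses.

(** * Components of one graph relative to a set of vertices *)

Section OneGraph.
Variables (V E : finType) (G : graph V E) (S : {set E}).

Lemma adj_sym : symmetric (adj G S).
Proof. by move=> x y; apply: eq_existsb => e; rewrite setUC. Qed.

Lemma connect_adj_sym : connect_sym (adj G S).
Proof. exact: sym_connect_sym adj_sym. Qed.

Hypothesis sSG : S \subset eset G.

Lemma adj_vset x y : adj G S x y -> (x \in vset G) && (y \in vset G).
Proof.
case/exists_inP => e eS /eqP endsE.
have := ends_vset (subsetP sSG e eS).
by rewrite endsE subUset !sub1set.
Qed.

Lemma closed_vset : closed (adj G S) (vset G).
Proof. by move=> x y /adj_vset/andP[-> ->]. Qed.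

(** The components of (V(G), S) that avoid U.  They are kept as vertex sets, so
    that components of different graphs can be compared. *)
Definition free_components (U : {set V}) : {set {set V}} :=
  [set B in equivalence_partition (connect (adj G S)) (vset G)
     | [disjoint B & U]].

Lemma omega_boundary (U : {set V}) :
  U \subset vset G ->
  omega G S = (#|boundary G U S| + #|free_components U|)%N.
Proof.
move=> sU; rewrite /omega (n_comp_equivalence_partition connect_adj_sym closed_vset).
exact: card_equivalence_partition_sub (connect_adj_equiv G S) sU.
Qed.

Lemma mem_pblock_boundary (U : {set V}) x y :
  x \in U -> y \in U -> (y \in pblock (boundary G U S) x) = connect (adj G S) x y.
Proof.
move=> xU yU; rewrite pblock_equivalence_partition //.
by move=> a b c *; apply: connect_adj_equiv.
Qed.

Lemma pblock_boundary (U : {set V}) x y :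
  y \in pblock (boundary G U S) x -> (x \in U) && (y \in U).
Proof.
have /and3P[/eqP cov _ _] := boundary_partition G U S.
rewrite -{2 3}cov => xy; have xc: x \in cover (boundary G U S).
  rewrite -mem_pblock; move: xy; rewrite /pblock.
  by case: pickP => [B /andP[_]|]; rewrite ?inE.
rewrite xc; apply/bigcupP; exists (pblock (boundary G U S) x) => //.
exact: pblock_mem.
Qed.

End OneGraph.

(** * Components of a union of two graphs *)

Section Gluing.
Variables (V E : finType) (G K H : graph V E) (U : {set V}).
Hypothesis GKH : is_union G K H U.
Variables A B : {set E}.
Hypotheses (sA : A \subset eset K) (sB : B \subset eset H).

Lemma is_union_sym : is_union G H K U.
Proof.
case: GKH => vG vU [eG d eK eH]; split; [by rewrite setUC | by rewrite setIC |].
by split; rewrite // 1?setUC // disjoint_sym.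
Qed.

Lemma adj_union x y : adj G (A :|: B) x y = adj K A x y || adj H B x y.
Proof.
case: GKH => _ _ [_ _ eK eH].
apply/exists_inP/orP => [[e]|].
  rewrite inE => /orP[eA | eB] /eqP eE; [left | right];
    apply/exists_inP; exists e => //.
    by rewrite -eK ?eE // (subsetP sA).
  by rewrite -eH ?eE // (subsetP sB).
case=> /exists_inP[e eS /eqP eE]; exists e; rewrite ?inE ?eS ?orbT //.
  by rewrite eK ?eE // (subsetP sA).
by rewrite eH ?eE // (subsetP sB).
Qed.

Lemma glue_sub_vset : (U \subset vset K) * (U \subset vset H) * (U \subset vset G).
Proof.
case: GKH => vG <- _; rewrite subsetIl subsetIr vG.
by rewrite (subset_trans (subsetIl _ _)) ?subsetUl.
Qed.

(** Cut a walk of G between two vertices of U where it changes from edges of K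
    to edges of H or back.  Such a vertex is in both graphs, hence in U, so each
    piece joins two vertices of the same block of one of the two boundary
    partitions. *)
Lemma connect_union x y : x \in U -> y \in U ->
  connect (adj G (A :|: B)) x y =
  join_rel (boundary K U A) (boundary H U B) x y.
Proof.
move=> xU yU; set J := join_rel _ _.
have [[sUK sUH] sUG] := glue_sub_vset.
have JK u v : u \in U -> v \in U -> connect (adj K A) u v -> J u v.
  by move=> uU vU uv; apply: connect1; rewrite mem_pblock_boundary ?uv.
have JH u v : u \in U -> v \in U -> connect (adj H B) u v -> J u v.
  move=> uU vU uv; apply: connect1.
  by rewrite [X in _ || X]mem_pblock_boundary ?uv ?orbT.
have UP z : z \in vset K -> z \in vset H -> z \in U.
  by case: GKH => _ <- _; rewrite inE => -> ->.
apply/idP/idP; last first.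
  apply: connect_sub => {xU yU} {}x {}y /orP[] /[dup] /pblock_boundary /andP[xU yU];
    rewrite mem_pblock_boundary //; apply: connect_sub => u v uv;
    by rewrite connect1 // adj_union uv ?orbT.
(* Invariant along a walk from x: its current end z is reached within one
   side from a vertex u of U that is already related to x. *)
pose near z := exists2 u, u \in U &
  J x u /\ (connect (adj K A) u z \/ connect (adj H B) u z).
suff nearP z : connect (adj G (A :|: B)) x z -> near z.
  move/nearP=> [u uU [xu [uy|uy]]]; apply: connect_trans xu _.
    exact: JK.
  exact: JH.
case/connectP => s; elim/last_ind: s z => [|s w IHs] z /=.
  by move=> _ ->; exists x => //; split; [apply: connect0 | left].
rewrite rcons_path last_rcons.
case/andP=> /IHs/(_ erefl)[u uU [xu uz]] zw ->.
set z' := last x s in uz zw.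
have [uK uH] : u \in vset K /\ u \in vset H by rewrite (subsetP sUK) ?(subsetP sUH).
rewrite adj_union in zw; case/orP: zw => zw; case: uz => uz.
- by exists u => //; split=> //; left; apply: connect_trans uz (connect1 zw).
- have z'U : z' \in U.
    apply: UP; first by case/andP: (adj_vset sA zw).
    by rewrite -(closed_connect (closed_vset sB) uz).
  exists z' => //; split; last by left; apply: connect1.
  by apply: connect_trans xu _; apply: JH.
- have z'U : z' \in U.
    apply: UP; last by case/andP: (adj_vset sB zw).
    by rewrite -(closed_connect (closed_vset sA) uz).
  exists z' => //; split; last by right; apply: connect1.
  by apply: connect_trans xu _; apply: JK.
- by exists u => //; split=> //; right; apply: connect_trans uz (connect1 zw).
Qed.

Lemma connect_union_sub x y :
  connect (adj K A) x y -> connect (adj G (A :|: B)) x y.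
Proof. by apply: connect_sub => u v uv; rewrite connect1 // adj_union uv. Qed.

(** To leave the K-component of x a walk would have to use an edge of H at a
    vertex of that component; this vertex would lie in U. *)
Lemma connect_union_free x : x \in vset K ->
    [disjoint [set y in vset K | connect (adj K A) x y] & U] ->
  connect (adj G (A :|: B)) x =1 connect (adj K A) x.
Proof.
move=> xK xU y; apply/idP/idP; last exact: connect_union_sub.
case/connectP => s; elim/last_ind: s y => [|s w IHs] y /=.
  by move=> _ ->; apply: connect0.
rewrite rcons_path last_rcons => /andP[/IHs/(_ erefl) xz zw] ->.
rewrite adj_union in zw; case/orP: zw => [/connect1|/(adj_vset sB)/andP[zH _]].
  exact: connect_trans.
have zK : last x s \in vset K by rewrite -(closed_connect (closed_vset sA) xz).
have /setDP[] : last x s \in [set y in vset K | connect (adj K A) x y] :\: U.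
  by rewrite (setDidPl xU) inE zK.
by case: GKH => _ <- _; rewrite !inE zK zH.
Qed.

Lemma free_class_union x : x \in vset K ->
    [disjoint [set y in vset K | connect (adj K A) x y] & U] ->
  [set y in vset G | connect (adj G (A :|: B)) x y] =
  [set y in vset K | connect (adj K A) x y].
Proof.
move=> xK xU; apply/setP => y; rewrite !inE connect_union_free //.
case xy: (connect _ x y); rewrite ?andbF // !andbT.
rewrite -(closed_connect (closed_vset sA) xy) xK.
by case: GKH => -> _ _; rewrite inE -(closed_connect (closed_vset sA) xy) xK.
Qed.

(** The next two lemmas are the two inclusions for the K side of
    [free_components_union]; the H side follows from [is_union_sym]. *)
Lemma free_components_sub C :
  C \in free_components K A U -> C \in free_components G (A :|: B) U.
Proof.
rewrite !inE => /andP[/imsetP[x xK ->] xU]; rewrite xU andbT.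
apply/imsetP; exists x; last by rewrite free_class_union.
by case: GKH => -> _ _; rewrite inE xK.
Qed.

Lemma free_components_lift x : x \in vset K ->
    [disjoint [set y in vset G | connect (adj G (A :|: B)) x y] & U] ->
  [set y in vset G | connect (adj G (A :|: B)) x y] \in free_components K A U.
Proof.
move=> xK; set C := [set y in vset G | _] => CU.
have xU : [disjoint [set y in vset K | connect (adj K A) x y] & U].
  apply: disjointWl CU; apply/subsetP => y.
  rewrite !inE => /andP[yK /connect_union_sub->].
  by case: GKH => -> _ _; rewrite inE yK.
by rewrite inE CU andbT /C free_class_union //; apply/imsetP; exists x.
Qed.

End Gluing.

Section OmegaUnion.
Variables (V E : finType) (G K H : graph V E) (U : {set V}).
Hypothesis GKH : is_union G K H U.
Variables A B : {set E}.
Hypotheses (sA : A \subset eset K) (sB : B \subset eset H).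

Lemma free_components_union :
  free_components G (A :|: B) U =
  free_components K A U :|: free_components H B U.
Proof.
have HKG := is_union_sym GKH.
apply/setP => C; rewrite in_setU; apply/idP/orP => [|[]].
- rewrite inE => /andP[/imsetP[x xG ->] xU].
  have /setUP[xK|xH] : x \in vset K :|: vset H by case: GKH => <-.
    by left; apply: (free_components_lift GKH).
  right.
  by move: xU; rewrite setUC; apply: (free_components_lift HKG).
- exact: (free_components_sub GKH).
- by rewrite setUC; apply: (free_components_sub HKG).
Qed.

(** A component of both sides is nonempty and contained in both vertex sets, so
    it would meet U. *)
Lemma free_components_disjoint :
  [disjoint free_components K A U & free_components H B U].
Proof.
apply/pred0P => C /=; apply/negP; rewrite !inE.
case/andP=> /andP[/imsetP[x xK eC] CU].
case/andP=> /imsetP[y yH eC'] _.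
have xC : x \in C by rewrite eC inE xK connect0.
have /setDP[_] : x \in C :\: U by rewrite (setDidPl CU).
case: GKH => _ <- _; rewrite inE xK.
by move: xC; rewrite eC' inE => /andP[->].
Qed.

(** The identity behind the degree comparison, with the subtractions moved to
    the other side so that it can be stated in the natural numbers. *)
Lemma omega_union :
  (omega G (A :|: B) + #|boundary K U A| + #|boundary H U B| =
   omega K A + omega H B +
   #|equivalence_partition (join_rel (boundary K U A) (boundary H U B)) U|)%N.
Proof.
have [[sUK sUH] sUG] := glue_sub_vset GKH.
have sAB : A :|: B \subset eset G by case: GKH => _ _ [-> _ _ _]; apply: setUSS.
rewrite (omega_boundary sAB sUG) (omega_boundary sA sUK) (omega_boundary sB sUH).
rewrite free_components_union cardsU (disjoint_setI0 free_components_disjoint).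
rewrite cards0 subn0 {1}/boundary.
rewrite (eq_equivalence_partition (connect_union GKH sA sB)).
have arith j f g a b : (j + (f + g) + a + b = a + f + (b + g) + j)%N by lia.
exact: arith.
Qed.

End OmegaUnion.

(** * Comparing the two sides *)

Section StateSums.
Variables (k : fieldType) (V E : finType).

Definition N0_degree (G : graph V E) (S : {set E}) : degree :=
  ((omega G S)%:Z, #|S|%:Z, #|eset G|%:Z - #|S|%:Z).

Definition NU_degree (U : {set V}) (p : Pi U) (K : graph V E) (S : {set E}) :
    degree :=
  ((omega K S)%:Z - #|val p|%:Z, #|S|%:Z, #|eset K|%:Z - #|S|%:Z).

Lemma has_degrees_N0 (G : graph V E) :
  has_degrees (N0 k G)
    (fun S : {S : {set E} | S \subset eset G} => N0_degree G (val S)).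
Proof. exact: has_degrees_gdsum_kshift. Qed.

Lemma has_degrees_NU U (p : Pi U) (K : graph V E) :
  has_degrees (NU k p K)
    (fun S : {S : {set E} |
                (S \subset eset K) && (boundary K U S == val p)} =>
      NU_degree p K (val S)).
Proof. exact: has_degrees_gdsum_kshift. Qed.

Lemma degree_of_union (w a b wK wH j eK eH cA cB : nat) :
  (w + a + b = wK + wH + j)%N ->
  (w%:Z, (cA + cB)%N%:Z, (eK + eH)%N%:Z - (cA + cB)%N%:Z) =
  (wK%:Z - a%:Z, cA%:Z, eK%:Z - cA%:Z) + (j%:Z, 0, 0) +
  (wH%:Z - b%:Z, cB%:Z, eH%:Z - cB%:Z) :> degree.
Proof.
move=> e; transitivity (wK%:Z - a%:Z + j%:Z + (wH%:Z - b%:Z),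
  cA%:Z + 0 + cB%:Z, eK%:Z - cA%:Z + 0 + (eH%:Z - cB%:Z)); last by [].
by congr (_, _, _); lia.
Qed.

Lemma sum_subset_union (X Y : {set E}) (F : {set E} -> nat) :
  [disjoint X & Y] ->
  (\sum_(S : {set E} | S \subset X :|: Y) F S =
   \sum_(A : {set E} | A \subset X)
      \sum_(B : {set E} | B \subset Y) F (A :|: B))%N.
Proof.
move=> dXY; rewrite pair_big /=.
rewrite (reindex_onto (fun p : {set E} * {set E} => p.1 :|: p.2)
  (fun S => (S :&: X, S :&: Y))) /=.
  apply: eq_bigl => -[A B] /=; apply/andP/andP => [[sAB]|[sA sB]].
    by rewrite xpair_eqE => /andP[/eqP <- /eqP <-]; rewrite !subsetIr.
  split; first exact: setUSS.
  have dA : A :&: Y = set0.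
    by apply/eqP; rewrite setI_eq0; apply: disjointWl sA dXY.
  have dB : B :&: X = set0.
    by apply/eqP; rewrite setI_eq0 disjoint_sym; apply: disjointWr sB dXY.
  by rewrite xpair_eqE !setIUl dA dB setU0 set0U (setIidPl sA) (setIidPl sB) !eqxx.
by move=> S sS; rewrite -setIUr (setIidPl sS).
Qed.

(** Summing over a partition p and over the sets of edges inducing it is summing
    over all sets of edges, as each of them induces exactly one partition. *)
Lemma sum_boundary (K : graph V E) (U : {set V}) (F : {set E} -> Pi U -> nat) :
  (\sum_(p : Pi U)
      \sum_(S : {set E} | (S \subset eset K) && (boundary K U S == val p))
         F S p =
   \sum_(S : {set E} | S \subset eset K)
      F S (Sub (boundary K U S) (boundary_partition K U S)))%N.
Proof.
rewrite (exchange_big_dep (fun S : {set E} => S \subset eset K)) /=;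
  last by move=> p S _ /andP[].
apply: eq_bigr => S sS; rewrite sS /=; apply: big_pred1 => p /=.
by rewrite -(inj_eq val_inj) /= eq_sym.
Qed.

End StateSums.

Theorem theorem4p5 (k : fieldType) (V E : finType) (G K H : graph V E)
    (U : {set V}) (GKH : is_union G K H U) :
  gisom (N0 k G)
    (gdsum (fun pq : Pi U * Pi U =>
       gtens (gtens (NU k pq.1 K) (kshift k ((rho pq.1 pq.2)%:Z, 0, 0)))
             (NU k pq.2 H))).
Proof.
apply: gisom_of_dim => d; rewrite has_degrees_N0 dim_gpart_gdsum.
have [_ _ [eG dKH _ _]] := GKH.
pose F (A B : {set E}) (p q : Pi U) : nat :=
  NU_degree p K A + ((rho p q)%:Z, 0, 0) + NU_degree q H B == d.
rewrite -(big_sub [pred S : {set E} | S \subset eset G]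
  (fun S => (N0_degree G S == d) : nat)) /=.
transitivity (\sum_(p : Pi U) \sum_(q : Pi U)
   \sum_(A : {set E} | (A \subset eset K) && (boundary K U A == val p))
   \sum_(B : {set E} | (B \subset eset H) && (boundary H U B == val q))
      F A B p q)%N.
  rewrite eG sum_subset_union //.
  symmetry; under eq_bigr => p _ do rewrite exchange_big /=.
  rewrite (@sum_boundary _ _ _ U (fun A p => \sum_q
    \sum_(B : {set E} | (B \subset eset H) && (boundary H U B == val q))
      F A B p q)%N).
  apply: eq_bigr => A sA; rewrite (@sum_boundary _ _ _ U (fun B q => F A B _ q)).
  apply: eq_bigr => B sB; symmetry.
  rewrite /F; congr (nat_of_bool (_ == d)).
  have dAB : A :&: B = set0.
    by apply/eqP; rewrite setI_eq0; apply: disjointWl sA (disjointWr sB dKH).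
  have cG : #|eset G| = (#|eset K| + #|eset H|)%N.
    by rewrite eG cardsU (disjoint_setI0 dKH) cards0 subn0.
  have cAB : #|A :|: B| = (#|A| + #|B|)%N by rewrite cardsU dAB cards0 subn0.
  have := omega_union GKH sA sB; rewrite /N0_degree /NU_degree /rho /= cG cAB => eo.
  exact: degree_of_union.
rewrite pair_bigA; apply: eq_bigr => -[p q] _ /=.
rewrite (has_degrees_gtens (has_degrees_gtens (has_degrees_NU k p K)
  (has_degrees_kshift k ((rho p q)%:Z, 0, 0))) (has_degrees_NU k q H)).
rewrite (big_sub [pred A : {set E} | _ & _]).
(* The middle factor is one-dimensional: its basis is indexed by the unit
   type, over which the sum has a single term. *)
rewrite -(pair_bigA _ (fun At B => (NU_degree p K (val At.1) + ((rho p q)%:Z, 0, 0)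
  + NU_degree q H (val B) == d) : nat)).
rewrite -(pair_bigA _ (fun A t => \sum_B ((NU_degree p K (val A) + ((rho p q)%:Z, 0, 0)
  + NU_degree q H (val B))%R == d))%N) /=.
apply: eq_bigr => A _; rewrite (big_pred1 tt) => [|[] //].
exact: (big_sub [pred B : {set E} | _ & _]).
Qed.
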